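(* Let $\mathbf{a}$ be a weak composition of length $n$ with $N=\mathrm{rk}(\mathbf{a})$, and let $\varnothing$ denote the all-zero weak composition of length $n$. If $\varnothing=\mathbf{a}^{(0)}\prec\!\!\!\cdot\,\mathbf{a}^{(1)}\prec\!\!\!\cdot\,\cdots\prec\!\!\!\cdot\,\mathbf{a}^{(N)}=\mathbf{a}$ is a saturated chain in the key poset, then the filling of the key diagram of $\mathbf{a}$ obtained by placing $N-i+1$ into the unique cell of $\mathbf{a}^{(i)}/\mathbf{a}^{(i-1)}$ for each $i$ is a standard key tableau. Conversely, given $T\in\mathrm{SKT}(\mathbf{a})$, setting $\mathbf{a}^{(0)}=\varnothing$ and, for $i=1,\dots,N$, letting $\mathbf{a}^{(i)}$ be the diagram consisting of the cells of $T$ labeled $N,N-1,\dots,N-i+1$ yields a saturated chain from $\varnothing$ to $\mathbf{a}$ in the key poset.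
   Context: A weak composition of length $n$ is $\mathbf{a}=(a_1,\dots,a_n)$ with $a_i\in\mathbb{Z}_{\ge0}$; $\mathrm{rk}(\mathbf{a})=\sum a_i$. Its key diagram is the set of cells $(r,c)$ with $1\le c\le a_r$ (row $r$ counted from the bottom, rows left-justified); for $\mathbf{a}\subseteq\mathbf{b}$ (componentwise $\le$), $\mathbf{b}/\mathbf{a}$ is the set of cells of $\mathbf{b}$ not in $\mathbf{a}$. Key poset: $\mathbf{a}\preceq\mathbf{b}$ iff $a_i\le b_i$ for all $i$ and for all $i<j$ with $b_j>a_j$ and $a_i>a_j$ we have $b_i>b_j$. A saturated chain is a sequence $p_0\prec\!\!\!\cdot\, p_1\prec\!\!\!\cdot\,\cdots\prec\!\!\!\cdot\, p_N$ of successive cover relations ($q$ covers $p$ if $p\prec q$ with nothing strictly between). A standard key tableau of shape $\mathbf{a}$ is a bijective filling of the key diagram of $\mathbf{a}$ with $1,\dots,N$ such that entries decrease left to right along rows, and whenever an entry $i$ lies above (same column, higher row) an entry $k$ with $i<k$, there is an entry $j$ in the cell immediately right of $k$ and $i<j$. $\mathrm{SKT}(\mathbf{a})$ is the set of these. *)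

(* Defs.v *)
From HB Require Import structures.
From mathcomp Require Import all_boot all_order.

Set Implicit Arguments.
Unset Strict Implicit.
Unset Printing Implicit Defensive.

(* Rows are indexed by 'I_n, a larger index being a higher row. *)
Definition wcomp (n : nat) : Type := {ffun 'I_n -> nat}.

HB.instance Definition _ n := Choice.copy (wcomp n) {ffun 'I_n -> nat}.

Definition wcomp0 n : wcomp n := [ffun=> 0].

Definition rk n (a : wcomp n) : nat := \sum_(i < n) a i.

(* A cell is a pair (row, column), columns being numbered from 1. *)
Definition key_diagram n (a : wcomp n) : pred ('I_n * nat) :=
  [pred x : 'I_n * nat | 1 <= x.2 <= a x.1].

Definition skew_diagram n (b a : wcomp n) : pred ('I_n * nat) :=
  [pred x | (x \in key_diagram b) && (x \notin key_diagram a)].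

Definition key_le n (a b : wcomp n) : bool :=
  [forall i, a i <= b i] &&
  [forall i : 'I_n, forall j : 'I_n,
     [&& i < j, a j < b j & a j < a i] ==> (b j < b i)].

Fact key_display : Order.disp_t. Proof. exact: Order.Disp tt tt. Qed.

Fact key_le_refl n : reflexive (@key_le n).
Proof.
move=> a; apply/andP; split; first by apply/forallP.
by apply/forallP=> i; apply/forallP=> j; rewrite ltnn andbF.
Qed.

Fact key_le_anti n : antisymmetric (@key_le n).
Proof.
move=> a b /andP[/andP[/forallP ab _] /andP[/forallP ba _]].
by apply/ffunP=> i; apply/eqP; rewrite eqn_leq ab ba.
Qed.

Fact key_le_trans n : transitive (@key_le n).
Proof.
move=> b a c /andP[/forallP ab /forallP Hab] /andP[/forallP bc /forallP Hbc].
apply/andP; split; first by apply/forallP=> i; apply: leq_trans (ab i) (bc i).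
apply/forallP=> i; apply/forallP=> j; apply/implyP=> /and3P[ij ajc aji].
have {Hab}/implyP := forallP (Hab i) j; have {Hbc}/implyP := forallP (Hbc i) j.
rewrite ij aji andbT /=.
case: (ltnP (a j) (b j)) => [ajb Hbc /(_ isT) bji | bja Hbc _].
  case: (ltnP (b j) (c j)) => [bjc | cjb]; first by apply: Hbc; rewrite bjc.
  exact: leq_ltn_trans cjb (leq_trans bji (bc i)).
by apply: Hbc; rewrite (leq_ltn_trans bja ajc) (leq_ltn_trans bja) ?(leq_trans aji).
Qed.

HB.instance Definition _ n :=
  Order.Le_isPOrder.Build key_display (wcomp n)
    (@key_le_refl n) (@key_le_anti n) (@key_le_trans n).

Definition covered_by d (P : porderType d) (p q : P) : Prop :=
  (p < q)%O /\ ~ exists r : P, (p < r)%O /\ (r < q)%O.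

(* The chain p 0, ..., p N; the values of p beyond N play no role. *)
Definition saturated_chain d (P : porderType d) (N : nat) (p : nat -> P) : Prop :=
  forall i, i < N -> covered_by (p i) (p i.+1).

(* A filling is a function on all of 'I_n * nat, of which only the values on
   the diagram matter. *)
Definition is_SKT n (a : wcomp n) (T : 'I_n * nat -> nat) : Prop :=
  [/\ {in key_diagram a, forall x, 1 <= T x <= rk a},
      {in key_diagram a &, injective T}
    & forall k, 1 <= k <= rk a -> exists2 x, x \in key_diagram a & T x = k] /\
  [/\ forall r c c', (r, c) \in key_diagram a -> (r, c') \in key_diagram a ->
        c < c' -> T (r, c') < T (r, c)
    & forall (r r' : 'I_n) c,
        (r, c) \in key_diagram a -> (r', c) \in key_diagram a ->
        r < r' -> T (r', c) < T (r, c) ->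
        (r, c.+1) \in key_diagram a /\ T (r', c) < T (r, c.+1)].

Definition filling_of_chain n (N : nat) (A : nat -> wcomp n)
    (T : 'I_n * nat -> nat) : Prop :=
  forall i, 1 <= i <= N ->
    {in skew_diagram (A i) (A i.-1), forall x, T x = N - i + 1}.

Definition chain_of_filling n (a : wcomp n) (T : 'I_n * nat -> nat)
    (A : nat -> wcomp n) : Prop :=
  A 0 = wcomp0 n /\
  forall i, 1 <= i <= rk a ->
    key_diagram (A i) =i
      [pred x | (x \in key_diagram a) && (rk a - i + 1 <= T x <= rk a)].

(* Main.v *)
Require Import Defs.
From mathcomp Require Import all_boot all_order.
From mathcomp Require Import zify.

Set Implicit Arguments.
Unset Strict Implicit.
Unset Printing Implicit Defensive.

(** Rank is strictly increasing in the key order, so a chain of length [rk a]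
    from the empty composition to [a] adds exactly one cell at each step, and
    conversely a key-increasing step adding one cell is a cover.  Adding a cell
    in column [c] of row [j] is a key-increasing step iff no row below [j] has
    length exactly [c].  When [(i, c)] precedes [(j, c)] with [i < j], this says
    that [(i, c + 1)] precedes [(j, c)] too, which is the condition of standard
    key tableaux since cells added later carry smaller entries. *)

(** * Diagrams, containment and rank *)

Lemma mem_key_diagram n (a : wcomp n) r c :
  ((r, c) \in key_diagram a) = (1 <= c <= a r).
Proof. by []. Qed.

Lemma mem_skew_diagram n (a b : wcomp n) x :
  (x \in skew_diagram b a) = (x \in key_diagram b) && (x \notin key_diagram a).
Proof. by []. Qed.

Lemma key_le_leq n (a b : wcomp n) : key_le a b -> forall i, a i <= b i.
Proof. by case/andP=> /forallP. Qed.

Lemma key_diagram_leq n (a b : wcomp n) :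
  {subset key_diagram a <= key_diagram b} -> forall i, a i <= b i.
Proof.
move=> sab i; case: (posnP (a i)) => [-> //|ai_gt0].
by have := sab (i, a i); rewrite !mem_key_diagram ai_gt0 leqnn => /(_ isT).
Qed.

Lemma sub_key_diagram n (a b : wcomp n) :
  (forall i, a i <= b i) -> {subset key_diagram a <= key_diagram b}.
Proof.
by move=> ab [r c]; rewrite !mem_key_diagram; have := ab r; lia.
Qed.

Lemma key_diagram_inj n (a b : wcomp n) : key_diagram a =i key_diagram b -> a = b.
Proof.
move=> eab; apply/ffunP=> i; apply/eqP; rewrite eqn_leq.
by apply/andP; split; apply: key_diagram_leq => x; rewrite eab.
Qed.

Lemma leq_rk n (a b : wcomp n) : (forall i, a i <= b i) -> rk a <= rk b.
Proof. by move=> ab; apply: leq_sum. Qed.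

Lemma eq_rk n (a b : wcomp n) : (forall i, a i <= b i) -> rk a = rk b -> a = b.
Proof.
move=> ab eab; apply/ffunP=> i.
have /leqif_sum H : forall i, true -> a i <= b i ?= iff (a i == b i).
  by move=> j _; split.
have [_] := H; rewrite -[X in X == _]/(rk a) -[X in _ == X]/(rk b) eab eqxx.
by move/esym/forallP/(_ i)/eqP.
Qed.

Lemma ltn_rk n (a b : wcomp n) : (a < b)%O -> rk a < rk b.
Proof.
rewrite Order.POrderTheory.lt_neqAle => /andP[neq /key_le_leq ab].
rewrite ltn_neqAle leq_rk // andbT.
by apply: contra neq => /eqP /(eq_rk ab) ->.
Qed.

(** * Steps that add one cell *)

Definition adds_cell n (a b : wcomp n) (j : 'I_n) : Prop :=
  forall i, b i = a i + (i == j).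

Lemma adds_cell_rk n (a b : wcomp n) j : adds_cell a b j -> rk b = (rk a).+1.
Proof.
move=> st; rewrite /rk (eq_bigr _ (fun i _ => st i)) big_split /=.
by rewrite -big_mkcond /= big_pred1_eq addn1.
Qed.

(** Raising by one a row in which [a] and [b] differ gives a composition still below [b] and of the
    same rank as [b], hence equal to [b]. *)
Lemma rk_adds_cell n (a b : wcomp n) :
  (forall i, a i <= b i) -> rk b = (rk a).+1 -> exists j, adds_cell a b j.
Proof.
move=> ab eab; have [/existsP[j lt_j]|/existsPn nlt] := boolP [exists j, a j < b j].
  exists j; pose c : wcomp n := [ffun i => a i + (i == j)].
  have st : adds_cell a c j by move=> i; rewrite ffunE.
  suff <- : c = b by [].
  apply: eq_rk; last by rewrite eab; apply: adds_cell_rk st.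
  by move=> i; rewrite st; case: eqP => [->|_]; rewrite ?addn1 ?addn0.
by have: rk b <= rk a; [apply: leq_rk => i; rewrite leqNgt nlt | rewrite eab ltnn].
Qed.

Lemma adds_cell_skew n (a b : wcomp n) j :
  adds_cell a b j -> skew_diagram b a =i pred1 (j, b j).
Proof.
move=> st [r c]; rewrite mem_skew_diagram !mem_key_diagram inE xpair_eqE st.
by case: (eqVneq r j) => [->|_]; rewrite ?st ?eqxx; lia.
Qed.

Lemma skew_adds_cell n (a b : wcomp n) x :
  (forall i, a i <= b i) -> skew_diagram b a =i pred1 x -> adds_cell a b x.1.
Proof.
case: x => j c ab sk i /=.
have mem r d : (1 <= d <= b r) && ~~ (1 <= d <= a r) = (r == j) && (d == c).
  by have := sk (r, d); rewrite mem_skew_diagram !mem_key_diagram inE xpair_eqE.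
(* Columns [b i] and [(a i).+1] are the two ends of row [i] of the skew diagram; column [c] shows
   that this row is nonempty when [i] is [j]. *)
have := ab i; have := mem i (b i); have := mem i (a i).+1; have := mem i c.
by case: (i == j) => /=; lia.
Qed.

(** Only pairs with upper row [j] are constrained: there [a j < a i] must give [a j + 1 < a i],
    which fails exactly when [a i = b j]. *)
Lemma adds_cell_key_le n (a b : wcomp n) j : adds_cell a b j ->
  reflect (forall i : 'I_n, i < j -> a i != b j) (key_le a b).
Proof.
move=> st; apply: (iffP idP) => [/andP[_ /forallP H] i ij|H].
  have /implyP := forallP (H i) j; rewrite ij !st eqxx.
  have -> : (i == j) = false by rewrite -val_eqE ltn_eqF.
  by lia.
apply/andP; split; apply/forallP=> i; first by rewrite st leq_addr.
apply/forallP=> k; apply/implyP=> /and3P[ik].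
rewrite st -[X in X < _]addn0 ltn_add2l lt0b => /eqP kj.
by move: ik; rewrite kj => /H; rewrite !st eqxx; lia.
Qed.

(** An intermediate element would have rank strictly between [rk a] and [rk a + 1]. *)
Lemma adds_cell_covered_by n (a b : wcomp n) j :
  adds_cell a b j -> key_le a b -> covered_by a b.
Proof.
move=> st ab; have eab := adds_cell_rk st; split.
  rewrite Order.POrderTheory.lt_neqAle; apply/andP; split=> //.
  by apply/eqP=> e; move: eab; rewrite e; lia.
by case=> r [/ltn_rk ar /ltn_rk rb]; lia.
Qed.

Lemma count_leq_iota t m : count (leq t) (iota 0 m) = m - t.
Proof. by elim: m => // m IH; rewrite -addn1 iotaD count_cat IH /=; lia. Qed.

(** * From saturated chains to tableaux *)

Section TableauOfChain.

Variables (n : nat) (a : wcomp n) (A : nat -> wcomp n).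
Hypothesis satA : saturated_chain (rk a) A.
Hypothesis A0 : A 0 = wcomp0 n.
Hypothesis AN : A (rk a) = a.

Lemma chain_key_le i : i < rk a -> key_le (A i) (A i.+1).
Proof. by case/satA=> /Order.POrderTheory.ltW. Qed.

(** Each step raises the rank by at least one: counting up from index 0 gives [i <= rk (A i)],
    counting down from [A (rk a) = a] gives the converse bound. *)
Lemma chain_rk i : i <= rk a -> rk (A i) = i.
Proof.
have ltA j : j < rk a -> rk (A j) < rk (A j.+1) by case/satA=> /ltn_rk.
have lo j : j <= rk a -> j <= rk (A j).
  by elim: j => // j IH jN; apply: leq_ltn_trans (ltA j jN); apply/IH/ltnW.
have hi d : d <= rk a -> rk (A (rk a - d)) + d <= rk a.
  elim: d => [|d IH] dN; first by rewrite subn0 addn0 AN.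
  have := ltA (rk a - d.+1); have -> : (rk a - d.+1).+1 = rk a - d by lia.
  by have := IH (ltnW dN); lia.
by move=> iN; have := lo i iN; have := hi (rk a - i); rewrite subKn //; lia.
Qed.

Lemma chain_adds_cell i : i < rk a -> exists j, adds_cell (A i) (A i.+1) j.
Proof.
move=> iN; apply: rk_adds_cell; first exact/key_le_leq/chain_key_le.
by rewrite !chain_rk // ltnW.
Qed.

Lemma chain_sub i j : i <= j -> j <= rk a ->
  {subset key_diagram (A i) <= key_diagram (A j)}.
Proof.
move=> ij jN x; elim: j ij jN => [|j IH]; first by rewrite leqn0 => /eqP ->.
rewrite leq_eqVlt => /predU1P[-> //|ij] jN /(IH ij (ltnW jN)).
exact/sub_key_diagram/key_le_leq/chain_key_le.
Qed.

Lemma chain_skew_unique i : 1 <= i <= rk a ->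
  exists! x, x \in skew_diagram (A i) (A i.-1).
Proof.
case: i => // i /= iN; have [j st] := chain_adds_cell iN.
exists (j, A i.+1 j); split=> [|y]; rewrite (adds_cell_skew st) inE //.
by move/eqP.
Qed.

Lemma chain_skew_mem t x : 1 <= t -> x \in skew_diagram (A t) (A t.-1) ->
  forall i, t <= rk a -> i <= rk a -> (x \in key_diagram (A i)) = (t <= i).
Proof.
move=> t_gt0 /andP[xt xt'] i tN iN; case: (leqP t i) => ti.
  exact: (@chain_sub t i).
apply/negbTE; apply: contra xt'; apply: chain_sub; lia.
Qed.

Lemma chain_entry x : x \in key_diagram a ->
  exists2 t, 1 <= t <= rk a & x \in skew_diagram (A t) (A t.-1).
Proof.
move=> xa; have exA : exists t, x \in key_diagram (A t) by exists (rk a); rewrite AN.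
(* The step sought is the least index whose diagram contains [x]; it is positive because [A 0] is
   empty. *)
case: (ex_minnP exA) => t xt mint.
have tN : t <= rk a by apply: mint; rewrite AN.
have t_gt0 : 0 < t.
  case: t xt {mint tN} => // ; case: x {xa exA} => r c.
  by rewrite A0 mem_key_diagram ffunE; lia.
exists t; rewrite ?t_gt0 // mem_skew_diagram xt /=.
by apply/negP=> /mint; lia.
Qed.

(* The number of [i <= rk a] with [x] in [A i] is [rk a - t + 1] if [x] is added
   at step [t]. *)
Lemma filling_exists : exists T, filling_of_chain (rk a) A T.
Proof.
exists (fun x => count (fun i => x \in key_diagram (A i)) (iota 0 (rk a).+1)).
move=> t /andP[t_gt0 tN] x xt.
rewrite [LHS](_ : _ = count (leq t) (iota 0 (rk a).+1)).
  by rewrite count_leq_iota; lia.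
apply: eq_in_count => i; rewrite mem_iota add0n ltnS => iN.
exact: chain_skew_mem.
Qed.

Variable T : 'I_n * nat -> nat.
Hypothesis fillT : filling_of_chain (rk a) A T.

Lemma filling_range x : x \in key_diagram a -> 1 <= T x <= rk a.
Proof. by case/chain_entry=> t tN /(fillT tN) ->; lia. Qed.

(** A cell added at step [t] has entry [rk a - t + 1], so [t <= i] becomes a bound on the entry. *)
Lemma filling_mem x i : x \in key_diagram a -> i <= rk a ->
  (x \in key_diagram (A i)) = (rk a < T x + i).
Proof.
case/chain_entry=> t /andP[t_gt0 tN] xt iN; rewrite (@chain_skew_mem t) //.
by rewrite (@fillT t) ?t_gt0 //; lia.
Qed.

Lemma filling_skew x : x \in key_diagram a ->
  x \in skew_diagram (A (rk a - T x).+1) (A (rk a - T x)).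
Proof.
move=> xa; have /andP[T_gt0 TN] := filling_range xa.
by rewrite mem_skew_diagram !filling_mem //; lia.
Qed.

Lemma filling_inj : {in key_diagram a &, injective T}.
Proof.
move=> x y xa ya eT; have xs := filling_skew xa.
have ys := filling_skew ya; rewrite -eT in ys.
have := filling_range xa => xN.
have [z [_ uniq_z]] : exists! z,
    z \in skew_diagram (A (rk a - T x).+1) (A (rk a - T x)).
  by apply: (@chain_skew_unique (rk a - T x).+1); lia.
by rewrite -(uniq_z x xs) -(uniq_z y ys).
Qed.

Lemma filling_SKT : is_SKT a T.
Proof.
split; split.
- exact: filling_range.
- exact: filling_inj.
- move=> k kN; have tN : 1 <= rk a - k + 1 <= rk a by lia.
  have [x [xs _]] := chain_skew_unique tN; exists x.
    by case/andP: xs => xt _; rewrite -AN; apply: chain_sub xt; lia.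
  by rewrite (fillT tN xs); lia.
(* Any diagram of the chain containing [(r, c')] contains [(r, c)], so the entries weakly decrease;
   injectivity makes this strict. *)
- move=> r c c' ca ca' cc'; rewrite ltn_neqAle; apply/andP; split.
    by apply/eqP=> /(filling_inj ca' ca) [e]; rewrite e ltnn in cc'.
  have /andP[T_gt0 TN] := filling_range ca'.
  have ct' : (r, c') \in key_diagram (A (rk a - T (r, c')).+1).
    by rewrite filling_mem //; lia.
  have: (r, c) \in key_diagram (A (rk a - T (r, c')).+1).
    by move: ca ct'; rewrite !mem_key_diagram; lia.
  by rewrite filling_mem //; lia.
- move=> r r' c ca ca' rr' ltT.
  have /andP[T_gt0 TN] := filling_range ca'.
  (* The cell [(r', c)] is the one added between [A t] and [A t.+1]. *)
  have [t def_t] : exists t, t = rk a - T (r', c) by eexists.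
  have := filling_skew ca'; rewrite -def_t => c't.
  have tN : t < rk a by lia.
  have [j st] := chain_adds_cell tN.
  move: c't; rewrite (adds_cell_skew st) inE => /eqP[e ec]; subst j.
  have /(adds_cell_key_le st) /(_ r rr') := chain_key_le tN.
  rewrite -ec => neq_c.
  (* Having the larger entry, [(r, c)] is already in [A t]. Row [r] then has length at least [c],
     and not [c] by [neq_c], so [(r, c.+1)] is in [A t] too. *)
  have : (r, c) \in key_diagram (A t) by rewrite filling_mem //; lia.
  rewrite mem_key_diagram => c_le.
  have ct : (r, c.+1) \in key_diagram (A t) by rewrite mem_key_diagram; lia.
  have c1a : (r, c.+1) \in key_diagram a.
    by rewrite -AN; apply: chain_sub ct; lia.
  by move: ct; rewrite (filling_mem c1a (ltnW tN)) => ct; split=> //; lia.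
Qed.

End TableauOfChain.

(** The solutions of [P] in [1..m] form an initial segment, whose length is the count; this turns a
    set of cells in a row into a row length. *)
Lemma leq_count_iota (P : pred nat) m c :
    (forall i j, 1 <= i -> i < j -> j <= m -> P j -> P i) ->
  1 <= c -> (c <= count P (iota 1 m)) = (c <= m) && P c.
Proof.
elim: m c => [|m IH] c dc c_gt0; first by case: c c_gt0 {dc}.
have dc' i j : 1 <= i -> i < j -> j <= m -> P j -> P i.
  by move=> i_gt0 ij /leqW; apply: dc.
rewrite -{1}(addn1 m) iotaD count_cat /= addn0 add1n.
case: (boolP (P m.+1)) => Pm; last first.
  rewrite addn0 IH //; case: (eqVneq c m.+1) => [->|]; last by lia.
  by rewrite (negbTE Pm) !andbF.
have -> : count P (iota 1 m) = m.
  rewrite -[RHS](size_iota 1); apply/eqP; rewrite -all_count; apply/allP=> i.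
  by rewrite mem_iota => im; apply: (dc i m.+1) => //; lia.
rewrite addn1; case: (leqP c m.+1) => //= cm; apply/esym.
by case: (eqVneq c m.+1) => [->//|cm1]; apply: (dc c m.+1) => //; lia.
Qed.

(** * From tableaux to saturated chains *)

Section ChainOfTableau.

Variables (n : nat) (a : wcomp n) (T : 'I_n * nat -> nat).
Hypothesis sktT : is_SKT a T.

Lemma chain_of_filling_exists : exists A, chain_of_filling a T A.
Proof.
have [[rangeT _ _] [rowT _]] := sktT.
(* Row [r] of [A i] counts the entries exceeding [rk a - i]. Since rows decrease, these fill the
   leftmost columns. *)
pose A i : wcomp n :=
  [ffun r : 'I_n => count (fun c => rk a < T (r, c) + i) (iota 1 (a r))].
have memA i (r : 'I_n) c : 1 <= c -> (c <= A i r) = (c <= a r) && (rk a < T (r, c) + i).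
  move=> c_gt0; rewrite ffunE leq_count_iota // => d d' d_gt0 dd' d'a.
  suff: T (r, d') < T (r, d) by lia.
  by apply: rowT => //; rewrite mem_key_diagram; lia.
exists A; split.
  apply/key_diagram_inj=> -[r c]; rewrite !mem_key_diagram [in RHS]ffunE.
  case: (posnP c) => [->//|c_gt0]; rewrite memA //=.
  case: (leqP c (a r)) => //= ca; last lia.
  have := rangeT (r, c); rewrite mem_key_diagram c_gt0 ca => /(_ isT); lia.
move=> i iN [r c]; rewrite [in RHS]inE !mem_key_diagram.
case: (posnP c) => [->//|c_gt0]; rewrite memA //=.
case: (leqP c (a r)) => //= ca.
have := rangeT (r, c); rewrite mem_key_diagram c_gt0 ca => /(_ isT); lia.
Qed.

Variable A : nat -> wcomp n.
Hypothesis chainA : chain_of_filling a T A.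

(** This form also covers [i = 0], where no entry exceeds [rk a]. *)
Lemma chain_of_filling_mem i x : i <= rk a ->
  (x \in key_diagram (A i)) = (x \in key_diagram a) && (rk a < T x + i).
Proof.
have [[rangeT _ _] _] := sktT; have [A0 AP] := chainA => iN.
have [xa|xa] /= := boolP (x \in key_diagram a); last first.
  case: (posnP i) => [->|i_gt0]; last by rewrite AP ?i_gt0 // [in LHS]inE (negbTE xa).
  by rewrite A0; case: x {xa} => r c; rewrite mem_key_diagram ffunE; lia.
have xN := rangeT _ xa; case: (posnP i) => [->|i_gt0].
  by rewrite A0; case: x xN {xa} => r c xN; rewrite mem_key_diagram ffunE; lia.
by rewrite AP ?i_gt0 // [in LHS]inE xa /=; lia.
Qed.

Lemma chain_of_filling_last : A (rk a) = a.
Proof.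
have [[rangeT _ _] _] := sktT; apply: key_diagram_inj => x.
by rewrite chain_of_filling_mem //; case: (boolP (_ \in _)) => // /rangeT /=; lia.
Qed.

Lemma chain_of_filling_saturated : saturated_chain (rk a) A.
Proof.
have [[_ injT surT] [_ keyT]] := sktT => t tN.
have leA i : A t i <= A t.+1 i.
  apply: key_diagram_leq => x; rewrite !chain_of_filling_mem ?(ltnW tN) //.
  by case/andP=> -> /=; lia.
(* The cell added at step [t.+1] carries the entry [rk a - t]. *)
have [x xa Tx] : exists2 x, x \in key_diagram a & T x = rk a - t by apply: surT; lia.
have sk : skew_diagram (A t.+1) (A t) =i pred1 x.
  move=> y; rewrite mem_skew_diagram !chain_of_filling_mem ?(ltnW tN) // [in RHS]inE.
  case: (eqVneq y x) => [->|yx]; first by rewrite xa Tx /=; lia.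
  case: (boolP (y \in _)) => //= ya.
  have: T y != T x by apply: contra yx => /eqP /(injT _ _ ya xa) ->.
  by rewrite Tx; lia.
have st := skew_adds_cell leA sk; apply: adds_cell_covered_by (st) _.
apply/(adds_cell_key_le st) => i ij.
have ex : x = (x.1, A t.+1 x.1).
  by have := sk x; rewrite (adds_cell_skew st) !inE eqxx => /eqP.
move: ij xa Tx; rewrite {}ex /=; move: x.1 (A t.+1 _) => j c ij ca Tc.
(* If a lower row [i] had length [c] in [A t], then [(i, c)] would have a larger entry than
   [(j, c)]. The key condition would give [(i, c.+1)] a larger entry too, putting it in [A t], a
   contradiction. *)
apply/eqP=> ei; have c_gt0 : 0 < c by case/andP: ca.
have : (i, c) \in key_diagram (A t) by rewrite mem_key_diagram ei leqnn c_gt0.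
rewrite chain_of_filling_mem ?(ltnW tN) // => /andP[ia Ti].
have [|c1a Tc1] := keyT _ _ _ ia ca ij; first lia.
have : (i, c.+1) \in key_diagram (A t).
  by rewrite chain_of_filling_mem ?(ltnW tN) // c1a /=; lia.
by rewrite mem_key_diagram ei ltnn andbF.
Qed.

End ChainOfTableau.

Theorem theorem3p5 (n : nat) (a : wcomp n) :
  (forall A : nat -> wcomp n,
     saturated_chain (rk a) A -> A 0 = wcomp0 n -> A (rk a) = a ->
     [/\ forall i, 1 <= i <= rk a ->
           exists! x, x \in skew_diagram (A i) (A i.-1),
         exists T, filling_of_chain (rk a) A T
       & forall T, filling_of_chain (rk a) A T -> is_SKT a T]) /\
  (forall T : 'I_n * nat -> nat, is_SKT a T ->
     (exists A, chain_of_filling a T A) /\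
     (forall A, chain_of_filling a T A ->
        saturated_chain (rk a) A /\ A (rk a) = a)).
Proof.
split=> [A satA A0 AN|T sktT].
  split=> [i|| T fillT].
  - exact: chain_skew_unique.
  - exact: filling_exists.
  - exact: (@filling_SKT n a A).
split; first exact: chain_of_filling_exists.
move=> A chainA; split; first exact: (@chain_of_filling_saturated n a T).
exact: (@chain_of_filling_last n a T).
Qed.
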